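(* Let $R$ be a right nonsingular right self-injective ring. Then every finitely generated max-projective right $R$-module is projective.
   Context: Rings are associative with identity; modules are unital right modules. A right $R$-module $M$ is max-projective if for every maximal right ideal $I$ of $R$, every homomorphism $M\to R/I$ factors through the canonical projection $R\to R/I$. $R$ is right nonsingular if the singular submodule $Z(R_R)$ is zero, and right self-injective if $R_R$ is injective. *)

(* Defs.v *)
From HB Require Import structures.
From mathcomp Require Import all_boot all_algebra.

Set Implicit Arguments.
Unset Strict Implicit.
Unset Printing Implicit Defensive.

Import GRing.Theory.
Local Open Scope ring_scope.
Local Open Scope quotient_scope.

(* A right R-module is a left module over the converse ring R^c: [r *: m] is
   m.r, and [(a : R^c) * b] is the product b a of R.  In particular the regular
   module R_R is (R^c)^o, in which [r *: x] is x r. *)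
Notation rmodType R := (lmodType (GRing.converse R)).
Notation regular_rmod R := (GRing.regular (GRing.converse R)).

Section QuotientModule.
Variables (S : pzRingType) (V : lmodType S) (U : submodClosed V).

(* [submodClosed] is stated over semirings and so does not record closure under
   opposites, which the library's quotient by an additive subgroup requires. *)
Definition submod_zmod : {pred V} := U.
Fact submod_zmod_closed : zmod_closed submod_zmod.
Proof. exact: GRing.submod_closedB (submodClosedP U). Qed.
HB.instance Definition _ :=
  GRing.isZmodClosed.Build V submod_zmod submod_zmod_closed.

(* The library only equips this quotient with a zmodType structure. *)
Definition quotmod : Type := Quotient.quot submod_zmod.
HB.instance Definition _ := GRing.Zmodule.on quotmod.

Definition quotmod_proj : V -> quotmod := \pi_(Quotient.quot submod_zmod).
Definition quotmod_scale (a : S) (x : quotmod) : quotmod :=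
  quotmod_proj (a *: repr (x : Quotient.quot submod_zmod)).

Lemma quotmod_eqP x y : reflect (quotmod_proj x = quotmod_proj y) (x - y \in U).
Proof. by rewrite -[_ \in U]/(_ \in submod_zmod) Quotient.idealrBE; apply: eqP. Qed.

Lemma quotmod_projK (x : quotmod) :
  quotmod_proj (repr (x : Quotient.quot submod_zmod)) = x.
Proof. exact: reprK. Qed.

Fact quotmod_proj_is_zmod_morphism : zmod_morphism quotmod_proj.
Proof. exact: (pi_is_zmod_morphism (Quotient.quot submod_zmod)). Qed.
HB.instance Definition _ :=
  GRing.isZmodMorphism.Build V quotmod quotmod_proj quotmod_proj_is_zmod_morphism.

Lemma quotmod_scaleE a x : quotmod_scale a (quotmod_proj x) = quotmod_proj (a *: x).
Proof.
apply/quotmod_eqP; rewrite -scalerBr rpredZ //.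
by apply/quotmod_eqP; rewrite quotmod_projK.
Qed.

Fact quotmod_scalerA a b x :
  quotmod_scale a (quotmod_scale b x) = quotmod_scale (a * b) x.
Proof. by rewrite -[x]quotmod_projK !quotmod_scaleE scalerA. Qed.
Fact quotmod_scale1r : left_id 1 quotmod_scale.
Proof. by move=> x; rewrite -[x]quotmod_projK quotmod_scaleE scale1r. Qed.
Fact quotmod_scalerDr : right_distributive quotmod_scale +%R.
Proof.
move=> a x y; rewrite -[x]quotmod_projK -[y]quotmod_projK -raddfD !quotmod_scaleE.
by rewrite scalerDr raddfD.
Qed.
Fact quotmod_scalerDl x : {morph quotmod_scale^~ x : a b / a + b}.
Proof.
by move=> a b /=; rewrite -[x]quotmod_projK !quotmod_scaleE scalerDl raddfD.
Qed.
HB.instance Definition _ := GRing.Zmodule_isLmodule.Build S quotmod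
  quotmod_scalerA quotmod_scale1r quotmod_scalerDr quotmod_scalerDl.

Fact quotmod_proj_is_scalable : scalable quotmod_proj.
Proof. by move=> a x; rewrite -quotmod_scaleE. Qed.
HB.instance Definition _ :=
  GRing.isScalable.Build S V quotmod *:%R quotmod_proj quotmod_proj_is_scalable.

End QuotientModule.

Section RightModules.
Variable R : pzRingType.

(* Right ideals are the submodules of [regular_rmod R]; like all
   [submodClosed] sets they are boolean predicates, which under classical
   axioms loses no subset. *)
Notation right_ideal := (submodClosed (regular_rmod R)).

Definition maximal_right_ideal (I : right_ideal) : Prop :=
  (exists x, x \notin I) /\
  forall J : right_ideal,
    {subset I <= J} -> (exists x, x \notin J) -> {subset J <= I}.

Definition max_projective (M : rmodType R) : Prop :=
  forall I : right_ideal, maximal_right_ideal I ->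
  forall f : {linear M -> quotmod I},
  exists g : {linear M -> regular_rmod R}, quotmod_proj I \o g =1 f.

Definition finitely_generated (M : rmodType R) : Prop :=
  exists (n : nat) (e : 'I_n -> M),
    forall m : M, exists c : 'I_n -> R^c, m = \sum_(i < n) c i *: e i.

Definition projective (P : rmodType R) : Prop :=
  forall (A B : rmodType R) (p : {linear A -> B}) (f : {linear P -> B}),
    (forall b, exists a, p a = b) ->
    exists g : {linear P -> A}, p \o g =1 f.

Definition injective_module (E : rmodType R) : Prop :=
  forall (A B : rmodType R) (i : {linear A -> B}) (f : {linear A -> E}),
    injective i ->
    exists g : {linear B -> E}, g \o i =1 f.

Definition essential (M : rmodType R) (E : submodClosed M) : Prop :=
  forall J : submodClosed M,
    (exists2 x, x \in J & x != 0) -> exists2 x, x \in J & (x \in E) && (x != 0).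

Section Annihilator.
Variables (M : rmodType R) (m : M).

Definition annihilator : {pred regular_rmod R} := [pred r : R^c | r *: m == 0].

Fact annihilator_submod_closed : submod_closed annihilator.
Proof.
split=> [|a x y]; rewrite !inE ?scale0r // => /eqP xm0 /eqP ym0.
by rewrite scalerDl -scalerA xm0 ym0 scaler0 addr0.
Qed.
HB.instance Definition _ :=
  GRing.isSubmodClosed.Build R^c (regular_rmod R) annihilator
    annihilator_submod_closed.

End Annihilator.

(* Membership in the singular submodule Z(M). *)
Definition singular (M : rmodType R) (m : M) : Prop := essential (annihilator m).

Definition right_nonsingular : Prop :=
  forall x : regular_rmod R, singular x -> x = 0.

Definition right_self_injective : Prop := injective_module (regular_rmod R).

End RightModules.

(* Main.v *)
Require Import Defs.
From HB Require Import structures.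
From mathcomp Require Import all_boot all_algebra.
From mathcomp Require Import boolp classical_sets.

(** Let Z be the singular submodule of M and p a surjection from a free module
    V of finite rank n onto M.

    Since R is nonsingular, M / Z is nonsingular ([singular_closed]), so the
    preimage E of Z in V is an essentially closed submodule of V.  Since R is
    self-injective, so is V as a module, and hence E is a direct summand of V:
    a relative complement C of E, given by Zorn's lemma, makes E + C essential
    in V; the projection of E + C onto E extends to an endomorphism phi of V,
    and phi still takes values in E because E is closed
    ([singular_preimage_projection]).  In other words, Z splits off M with a
    projective complement p (ker phi).

    Max-projectivity forces Z into every maximal submodule N of M: a nonzero
    map from M / N to a simple module R / I lifts to a map from M to R, which
    kills Z because R has no nonzero singular element
    ([singular_in_maximal]).  If p (ker phi) were proper, finite generation
    would put it in a maximal submodule N; as N also contains Z and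
    M = Z + p (ker phi), this is absurd.  So the complement p (ker phi) of Z is
    all of M and Z = 0.  Then E = ker p is a direct summand of V, and M is
    projective ([projective_of_split]). *)

Set Implicit Arguments.
Unset Strict Implicit.
Unset Printing Implicit Defensive.

Import GRing.Theory.
Local Open Scope ring_scope.

(** * Building submodules and linear maps *)

Lemma linear_map_of (S : pzRingType) (V W : lmodType S) (f : V -> W) :
  linear f -> exists g : {linear V -> W}, g =1 f.
Proof.
move=> flin; pose mf := GRing.isLinear.Build S V W *:%R f flin.
by pose g : {linear V -> W} := HB.pack f mf; exists g.
Qed.

Section Submodules.
Variables (S : pzRingType) (V : lmodType S).

(** Submodules are boolean predicates; this turns a closed predicate in [Prop]
    into one, so that sums, preimages and cyclic submodules can be introduced
    by their membership condition alone. *)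
Lemma submodule_of (P : V -> Prop) :
    P 0 -> (forall a x y, P x -> P y -> P (a *: x + y)) ->
  exists U : submodClosed V, forall x, (x \in U) <-> P x.
Proof.
move=> P0 Plin.
pose Q : {pred V} := fun x => `[< P x >].
have Pc : GRing.submod_closed Q.
  split; first exact/asboolP.
  by move=> a x y /asboolP Px /asboolP Py; apply/asboolP/Plin.
pose mU := GRing.isSubmodClosed.Build S V Q Pc.
pose U : submodClosed V := HB.pack Q mU.
exists U => x; apply: iff_sym; apply: rwP; apply: asboolP.
Qed.

(** [submodClosed] records closure under sums and scaling only; opposites are
    recovered by scaling by -1. *)
Lemma submodule_opp (U : submodClosed V) (x : V) : x \in U -> - x \in U.
Proof. by move=> xU; rewrite -scaleN1r rpredZ. Qed.

Lemma submodule_sub (U : submodClosed V) (x y : V) :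
  x \in U -> y \in U -> x - y \in U.
Proof. by move=> xU yU; rewrite rpredD ?submodule_opp. Qed.

Lemma submodule_add_cyclic (U : submodClosed V) (x : V) :
  exists D : submodClosed V, forall y, y \in D <-> exists a, y - a *: x \in U.
Proof.
apply: submodule_of => [|b y z [c yU] [d zU]].
  by exists 0; rewrite scale0r subr0 rpred0.
exists (b * c + d); rewrite scalerDl -scalerA opprD addrACA -scalerBr.
by rewrite rpredD ?rpredZ.
Qed.

(** Zorn's lemma, with maximality phrased through cyclic extensions: if x is not
    in N then N + Sx meets T.  Taking for T the nonzero elements of E yields a
    complement of E; taking a singleton yields maximal submodules. *)
Lemma submodule_avoiding (U : submodClosed V) (T : V -> Prop) :
    (forall x, x \in U -> ~ T x) ->
  exists N : submodClosed V,
    [/\ {subset U <= N}, forall x, x \in N -> ~ T x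
      & forall x, x \notin N -> exists2 y, T y & exists a, y - a *: x \in N].
Proof.
move=> UT.
(* The chains are made of sets X whose union with U is a submodule, rather than
   of submodules above U, so that the empty chain needs no special treatment. *)
pose P (X : set V) := exists2 D : submodClosed V,
  forall x, x \in D <-> x \in U \/ X x & forall x, x \in D -> ~ T x.
have [F FP Ftot|X [[N NE NT] Nmax]] := @Zorn_bigcup V P.
  have [||D DE] := @submodule_of
      (fun x => x \in U \/ exists2 X, F X & X x).
  - by left; apply: rpred0.
  - move=> a x y.
    have sum1 X : F X -> x \in U \/ X x -> y \in U \/ X y ->
        a *: x + y \in U \/ exists2 X, F X & X (a *: x + y).
      move=> FX xX yX; have [D DE _] := FP X FX.
      have: a *: x + y \in D by rewrite rpredD ?rpredZ //; apply/DE.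
      by case/DE=> [|Xxy]; [left | right; exists X].
    move=> [xU [yU|[Y FY Yy]]|[X FX Xx] [yU|[Y FY Yy]]].
    + by left; rewrite rpredD ?rpredZ.
    + by apply: (sum1 Y) => //; [left | right].
    + by apply: (sum1 X) => //; [right | left].
    + have [XY|YX] := Ftot X Y FX FY.
        by apply: (sum1 Y) => //; right => //; apply: XY.
      by apply: (sum1 X) => //; right => //; apply: YX.
  exists D => [x|x /DE [/UT //|[X FX Xx]]].
    rewrite DE; split=> [[|[X FX Xx]]|[|[X FX Xx]]]; try by left.
      by right; exists X.
    by right; exists X.
  by have [D' DE' D'T] := FP X FX; apply: D'T; apply/DE'; right.
have XN x : X x -> x \in N by move=> Xx; apply/NE; right.
exists N; split=> // [x xU|x xN]; first by apply/NE; left.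
have [D DE] := submodule_add_cyclic N x.
have ND : {subset N <= D}.
  by move=> y yN; apply/DE; exists 0; rewrite scale0r subr0.
have xD : x \in D by apply/DE; exists 1; rewrite scale1r subrr rpred0.
apply: contrapT => noT; case: (Nmax [set y | y \in D]%classic).
  split=> [y /XN /ND //|DX]; move/negP: xN; apply.
  by apply: XN; apply: DX.
exists D => [y|y /DE yD Ty]; last by apply: noT; exists y.
split=> [|[yU|]] //; first by right.
by apply: ND; apply/NE; left.
Qed.

(** Proper submodules of finitely generated modules lie in maximal ones, where
    maximality of N is expressed as simplicity of V / N.  By adding the
    generators in [s] to C one at a time until nothing proper remains, one
    reaches a proper C' and a single generator e with V = C' + Se; a submodule
    above C' maximal for not containing e is then a maximal submodule. *)
Lemma submodule_simple_quotient (s : seq V) (C : submodClosed V) :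
    (exists x, x \notin C) ->
    (forall D : submodClosed V, {subset C <= D} -> {subset s <= D} ->
       forall x, x \in D) ->
  exists N : submodClosed V, [/\ {subset C <= N}, exists x, x \notin N
    & forall y, y \notin N -> forall z, exists a, z - a *: y \in N].
Proof.
elim: s C => [|e s IH] C [x xC] Cs.
  by move: xC; rewrite (Cs C).
have [D DE] := submodule_add_cyclic C e.
have CD : {subset C <= D}.
  by move=> y yC; apply/DE; exists 0; rewrite scale0r subr0.
have eD : e \in D by apply/DE; exists 1; rewrite scale1r subrr rpred0.
have [Dprop|Dfull] := pselect (exists y, y \notin D).
  have [D' DD' sD'|N [DN]] := IH D Dprop; last by exists N; split=> // y /CD/DN.
  apply: Cs => [y /CD/DD' //|y]; rewrite inE => /orP[/eqP ->|/sD' //].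
  exact: DD'.
have {Dfull} inD y : y \in D.
  by apply: contrapT => /negP yD; apply: Dfull; exists y.
have eC : e \notin C.
  apply: contra xC => eC; have /DE[a xa] := inD x.
  by rewrite -(subrK (a *: e) x) rpredD ?rpredZ.
have [y yC ey|N [CN Ne Nmax]] := @submodule_avoiding C (eq e).
  by move: eC; rewrite ey yC.
exists N; split=> //; first by exists e; apply/negP => /Ne.
move=> y /Nmax[_ <- [a eay]] z; have /DE[b zbe] := inD z.
exists (b * a); rewrite -[z](subrK (b *: e)) -addrA -scalerA -scalerBr.
by rewrite rpredD ?rpredZ //; apply: CN.
Qed.

Lemma free_module_map n (e : 'I_n -> V) :
  exists p : {linear 'rV[S]_n -> V}, forall x, p x = \sum_i x 0 i *: e i.
Proof.
apply: linear_map_of => b x y; rewrite scaler_sumr -big_split /=.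
by apply: eq_bigr => i _; rewrite !mxE scalerDl scalerA.
Qed.

(** Injectivity speaks of linear maps between modules, so extending a map
    defined on a submodule needs that submodule as a module in its own right. *)
Section SubmoduleType.
Variable U : submodClosed V.
Definition submodule_type := {x : V | x \in U}.
HB.instance Definition _ :=
  [isSub of submodule_type for @sval V (fun x => x \in U)].
HB.instance Definition _ := [Choice of submodule_type by <:].
HB.instance Definition _ := [SubChoice_isSubLmodule of submodule_type by <:].
End SubmoduleType.

End Submodules.

(** * Essential and singular elements *)

Section RightModules.
Variable R : pzRingType.

Lemma essentialE (M : rmodType R) (E : submodClosed M) :
  essential E <->
  forall x : M, x != 0 -> exists2 a : R^c, a *: x \in E & a *: x != 0.
Proof.
split=> [Ess x x0|Ess J [x xJ /Ess[a axE ax0]]]; last first.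
  by exists (a *: x); [apply: rpredZ | rewrite axE].
have [J JE] : exists J : submodClosed M,
    forall y, y \in J <-> exists a : R^c, y = a *: x.
  apply: submodule_of => [|a y z [b ->] [c ->]].
    by exists 0; rewrite scale0r.
  by exists (a * b + c); rewrite scalerDl scalerA.
have [|_ /JE[a ->] /andP[aE a0]] := Ess J; last by exists a.
by exists x => //; apply/JE; exists 1; rewrite scale1r.
Qed.

Lemma singularE (M : rmodType R) (m : M) :
  singular m <->
  forall s : R^c, s != 0 -> exists2 a : R^c, a * s != 0 & (a * s) *: m = 0.
Proof.
rewrite /singular essentialE; split=> h s /h[a].
  by rewrite inE => /eqP am0 as0; exists a.
by move=> as0 am0; exists a => //; rewrite inE; apply/eqP.
Qed.

(** The annihilator of xa + y contains the intersection of the annihilator of y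
    with the preimage of that of x under left multiplication by a; both are
    essential, and they are met in succession. *)
Lemma singular_linear (M : rmodType R) (a : R^c) (x y : M) :
  singular x -> singular y -> singular (a *: x + y).
Proof.
move=> /singularE Zx /singularE Zy; apply/singularE => s s0.
have [t ts0 tsa] : exists2 t : R^c, t * s != 0 & (t * s * a) *: x = 0.
  have [sa0|sa0] := eqVneq (s * a) 0.
    by exists 1; rewrite mul1r // sa0 scale0r.
  have [t tsa0 tsax] := Zx _ sa0.
  exists t; last by rewrite -mulrA.
  by apply: contraNneq tsa0 => ts0; rewrite mulrA ts0 mul0r.
have [u uts0 utsy] := Zy _ ts0.
exists (u * t); rewrite -mulrA // scalerDr utsy addr0 scalerA.
by rewrite -!mulrA -scalerA mulrA tsa scaler0.
Qed.

Lemma singular_map (M N : rmodType R) (f : {linear M -> N}) (x : M) :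
  singular x -> singular (f x).
Proof.
move=> /singularE Zx; apply/singularE => s /Zx[t ts0 tsx].
by exists t => //; rewrite -linearZ tsx linear0.
Qed.

Lemma singular0 (M : rmodType R) : singular (0 : M).
Proof. by apply/singularE => s s0; exists 1; rewrite ?mul1r ?scaler0. Qed.

(** Modulo its singular submodule, a module over a nonsingular ring becomes
    nonsingular.  Suppose that mJ consists of singular elements with J an
    essential right ideal, and let st be a nonzero element of J.  The
    annihilator K of mst is essential, and stK is not 0 since st is not a
    singular element of R; so some nonzero stu kills m. *)
Lemma singular_closed (hns : right_nonsingular R) (M : rmodType R) (m : M) :
    (forall s : R^c, s != 0 ->
       exists2 a : R^c, a * s != 0 & singular ((a * s) *: m)) ->
  singular m.
Proof.
move=> Zm; apply/singularE => s /Zm[t ts0 /singularE Ztsm].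
have: ~ singular (t * s : regular_rmod R) by move/hns => /eqP; apply/negP.
apply: contra_notP => noa; apply/singularE => u u0.
have [v vu0 vum] := Ztsm _ u0.
exists v => //; apply: contrapT => vuts; apply: noa.
exists (v * u * t); first by apply/eqP; rewrite -mulrA.
by rewrite -mulrA -scalerA.
Qed.

Lemma singular_maps_to0 (hns : right_nonsingular R) (M : rmodType R)
    (g : {linear M -> regular_rmod R}) (x : M) :
  singular x -> g x = 0.
Proof. by move=> /(singular_map g)/hns. Qed.

(** * Splitting off the singular submodule *)

Lemma injective_extend (E : rmodType R) (hE : injective_module E)
    (V : rmodType R) (U : submodClosed V) (h : V -> E) :
    (forall a x y, x \in U -> y \in U -> h (a *: x + y) = a *: h x + h y) ->
  exists g : {linear V -> E}, forall x, x \in U -> g x = h x.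
Proof.
move=> hlin.
have [i iE] := @linear_map_of _ (submodule_type U) V val
  (fun a x y => linearP val a x y).
have [f fE] := @linear_map_of _ (submodule_type U) E (h \o val)
  (fun a x y => etrans (congr1 h (linearP val a x y))
                       (hlin a _ _ (valP x) (valP y))).
have [|g gE] := hE _ _ i f; first by move=> x y; rewrite !iE; apply: val_inj.
exists g => x xU; have := gE (exist _ x xU : submodule_type U).
by rewrite /= iE fE.
Qed.

(** Finite powers of R are injective: maps into them extend coordinatewise. *)
Lemma free_module_extend (hinj : right_self_injective R) (V : rmodType R) n
    (U : submodClosed V) (h : V -> 'rV[R^c]_n) :
    (forall a x y, x \in U -> y \in U -> h (a *: x + y) = a *: h x + h y) ->
  exists g : {linear V -> 'rV[R^c]_n}, forall x, x \in U -> g x = h x.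
Proof.
move=> hlin.
have ext i : exists g : {linear V -> regular_rmod R},
    forall x, x \in U -> g x = h x 0 i.
  apply: (injective_extend hinj) => a x y xU yU.
  by rewrite hlin // !mxE.
have [g gE] := choice ext.
have [|G GE] := @linear_map_of _ V 'rV[R^c]_n (fun x => \row_i g i x).
  by move=> a x y; apply/rowP => i; rewrite !mxE linearP.
by exists G => x xU; rewrite GE; apply/rowP => i; rewrite mxE gE.
Qed.

(** The idempotent phi is the projection of the free module onto the preimage E
    of the singular submodule, along a submodule extending a complement of E.
    Its values lie in E because x is sent by an essential right ideal into
    E + C, on which phi is the projection onto E, and singular elements of M are
    detected on essential right ideals. *)
Lemma singular_preimage_projection (hns : right_nonsingular R)
    (hinj : right_self_injective R) n (M : rmodType R)
    (p : {linear 'rV[R^c]_n -> M}) :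
  exists phi : {linear 'rV[R^c]_n -> 'rV[R^c]_n},
    (forall x, singular (p x) -> phi x = x) /\
    (forall x, singular (p (phi x))).
Proof.
set V := 'rV[R^c]_n.
have [||E EE] := @submodule_of _ V (fun x => singular (p x)).
- by rewrite linear0; apply: singular0.
- by move=> a x y Zx Zy; rewrite linearP; apply: singular_linear.
have [O OE] : exists O : submodClosed V, forall x, x \in O <-> x = 0.
  by apply: submodule_of => // a x y -> ->; rewrite scaler0 addr0.
have [x /OE -> [_ /eqP] //|C [_ CE Cmax]] :=
  @submodule_avoiding _ V O (fun x => x \in E /\ x != 0).
have dis x : x \in E -> x \in C -> x = 0.
  by move=> xE xC; apply: contrapT => /eqP x0; apply: (CE x xC).
have [||D DE] := @submodule_of _ V (fun x => exists2 e, e \in E & x - e \in C).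
- by exists 0; rewrite ?subr0 rpred0.
- move=> a x y [e eE xe] [e' eE' ye']; exists (a *: e + e').
    by rewrite rpredD ?rpredZ.
  by rewrite opprD addrACA -scalerBr rpredD ?rpredZ.
have Dess : essential D.
  apply/essentialE => x x0; apply: contrapT => noa.
  have noD a : a *: x \in D -> a *: x = 0.
    by move=> axD; apply: contrapT => /eqP ax0; apply: noa; exists a.
  have [xC|/Cmax[y [yE y0] [a yax]]] := boolP (x \in C).
    move/eqP: x0; apply; rewrite -[x]scale1r; apply: noD; rewrite scale1r.
    by apply/DE; exists 0; rewrite ?subr0 ?rpred0.
  have ax0 : a *: x = 0.
    apply: noD; apply/DE; exists y => //.
    by rewrite -opprB; apply: submodule_opp.
  by move/eqP: y0; apply; apply: dis => //; move: yax; rewrite ax0 subr0.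
(* Off E + C the E-component is meaningless, and any value will do. *)
have projP x : exists e, x \in D -> e \in E /\ x - e \in C.
  have [/DE[e eE xe]|xD] := boolP (x \in D); first by exists e.
  by exists 0.
have [h hP] := choice projP.
have hE x e : e \in E -> x - e \in C -> h x = e.
  move=> eE xe; have [|hE xh] := hP x; first by apply/DE; exists e.
  apply/eqP; rewrite -subr_eq0; apply/eqP/dis; first exact: submodule_sub.
  rewrite (_ : h x - e = (x - e) - (x - h x)); first exact: submodule_sub.
  by rewrite opprB [RHS]addrC subrKA.
have [|phi phiE] := free_module_extend hinj (U := D) (h := h).
  move=> a x y /hP[xE xC] /hP[yE yC].
  apply: hE; first by rewrite rpredD ?rpredZ.
  by rewrite opprD addrACA -scalerBr rpredD ?rpredZ.
exists phi; split=> x.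
  move=> /EE xE; rewrite phiE.
  2: by apply/DE; exists x; rewrite ?subrr ?rpred0.
  by apply: hE; rewrite // subrr rpred0.
apply: (singular_closed hns) => s s0.
have phiD y : y \in D -> singular (p (phi y)).
  by move=> yD; rewrite phiE //; apply/EE; case: (hP y yD).
have [sx0|sx0] := eqVneq (s *: x) 0.
  exists 1; rewrite mul1r // -!linearZ sx0 !linear0.
  exact: singular0.
move/essentialE: Dess => /(_ _ sx0)[a axD ax0].
exists a; last by rewrite -!linearZ -scalerA; apply: phiD.
by apply: contraNneq ax0 => as0; rewrite scalerA as0 scale0r.
Qed.

(** * Simple quotients and projectivity *)

(** For I the annihilator of x modulo N, M / N is generated by the class of x
    and thus isomorphic to R / I; the map sends m to the class of any r with m - xr
    in N. *)
Lemma map_onto_simple (M : rmodType R) (N : submodClosed M) (x : M) :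
    x \notin N ->
    (forall y, y \notin N -> forall z, exists a : R^c, z - a *: y \in N) ->
  exists I : submodClosed (regular_rmod R), maximal_right_ideal I /\
  exists f : {linear M -> quotmod I}, f x != 0.
Proof.
move=> xN simple.
have [||I IE] := @submodule_of _ (regular_rmod R) (fun r : R^c => r *: x \in N).
- by rewrite scale0r rpred0.
- move=> a r s rN sN; rewrite [_ *: _](@scalerDl R^c M x (a * r) s) -scalerA.
  by apply: rpredD; [apply: rpredZ|].
have I1 : (1 : R^c) \notin I by apply: contra xN => /IE; rewrite scale1r.
exists I; split.
  split=> [|J IJ [u uJ] j jJ]; first by exists 1.
  apply/IE; apply: contrapT => /negP jxN.
  (* As M / N is simple, x - xja lies in N for some a, so 1 - ja is in I. *)
  have [a xajx] := simple _ jxN x.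
  move/negP: uJ; apply; rewrite -[u]mulr1.
  apply: (@rpredZ _ (regular_rmod R) J u).
  rewrite -[1](subrK (a *: j : regular_rmod R)) rpredD ?rpredZ //.
  by apply/IJ/IE; rewrite scalerBl scale1r -scalerA.
have [r rP] := choice (simple x xN).
have fE m a : m - a *: x \in N ->
    quotmod_proj I (r m) = quotmod_proj I (a : regular_rmod R).
  move=> ma; apply/quotmod_eqP/IE; rewrite scalerBl.
  rewrite (_ : r m *: x - a *: x = (m - a *: x) - (m - r m *: x)).
    exact: submodule_sub.
  by rewrite opprB [RHS]addrC subrKA.
have [|f fr] := @linear_map_of _ M (quotmod I) (fun m => quotmod_proj I (r m)).
  move=> a y z; rewrite -linearP; apply: fE.
  by rewrite scalerDl -scalerA opprD addrACA -scalerBr rpredD ?rpredZ.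
exists f; rewrite fr (fE _ 1) ?scale1r ?subrr ?rpred0 //.
apply: contra I1 => /eqP p1; rewrite -[1]subr0; apply/quotmod_eqP.
by rewrite p1 linear0.
Qed.

(** When phi projects the free module onto the kernel of p, 1 - phi factors
    through p, as a section of p; a lift G of f p to A then gives a lift of f,
    sending p x to G (x - phi x). *)
Lemma projective_of_split (n : nat) (M : rmodType R)
    (p : {linear 'rV[R^c]_n -> M}) (phi : {linear 'rV[R^c]_n -> 'rV[R^c]_n}) :
    (forall m, exists x, p x = m) -> (forall x, p (phi x) = 0) ->
    (forall x, p x = 0 -> phi x = x) ->
  projective M.
Proof.
move=> psurj pphi phiK A B q f qsurj.
have [a aP] := choice (fun i : 'I_n => qsurj (f (p (delta_mx 0 i)))).
have [G GE] := free_module_map a.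
have qG x : q (G x) = f (p x).
  rewrite GE linear_sum {2}(row_sum_delta x) !linear_sum; apply: eq_bigr => i _.
  by rewrite !linearZ aP.
have [s sP] := choice psurj.
have Gp x y : p x = p y -> G (x - phi x) = G (y - phi y).
  move=> pxy; congr (G _); apply/eqP.
  rewrite -subr_eq0 [- (y - _)]opprD addrACA -[- phi x - _]opprD -linearB.
  by rewrite phiK ?subrr // linearB pxy subrr.
have [|g gE] := @linear_map_of _ M A (fun m => G (s m - phi (s m))).
  move=> b m m'; rewrite -linearP.
  rewrite (Gp _ (b *: s m + s m')); last by rewrite linearP !sP.
  by congr (G _); rewrite linearP scalerBr opprD addrACA.
exists g => m; rewrite /= gE qG linearB pphi subr0 sP //.
Qed.

(** A map from M to R / I that is nonzero at x would lift to a map from M to R,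
    which kills the singular element x. *)
Lemma singular_in_maximal (hns : right_nonsingular R) (M : rmodType R)
    (hmp : max_projective M) (N : submodClosed M) :
    (forall y, y \notin N -> forall z, exists a : R^c, z - a *: y \in N) ->
  forall x, singular x -> x \in N.
Proof.
move=> simple x Zx; apply: contrapT => /negP xN.
have [I [maxI [f fx0]]] := map_onto_simple xN simple.
have [g gf] := hmp I maxI f.
by move: fx0; rewrite -gf /= (singular_maps_to0 hns) // linear0 eqxx.
Qed.

End RightModules.

Theorem proposition7 (R : pzRingType)
    (hns : right_nonsingular R) (hinj : right_self_injective R)
    (M : rmodType R) (hfg : finitely_generated M) (hmp : max_projective M) :
  projective M.
Proof.
have [n [e gen]] := hfg.
have [p pE] := free_module_map e.
have psurj m : exists x, p x = m.
  have [c ->] := gen m; exists (\row_i c i).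
  by rewrite pE; apply: eq_bigr => i _; rewrite mxE.
have [phi [phi_id phi_sing]] := singular_preimage_projection hns hinj p.
have phiK x : phi (phi x) = phi x by apply: phi_id.
have [||C CE] := @submodule_of _ M (fun m => exists2 x, phi x = 0 & p x = m).
- by exists 0; rewrite linear0.
- move=> a x y [u pu <-] [v pv <-].
  by exists (a *: u + v); rewrite linearP // pu pv scaler0 addr0.
(* C = p (ker phi) together with the singular submodule spans M, and the latter
   lies in every maximal submodule, so C is contained in none. *)
have Call m : m \in C.
  apply: contrapT => /negP mC.
  have [||N [CN [x xN] simple]] := @submodule_simple_quotient _ M (codom e) C.
  - by exists m.
  - move=> D _ eD x; have [c ->] := gen x.
    by apply: rpred_sum => i _; apply/rpredZ/eD/codom_f.
  move/negP: xN; apply; have [y <-] := psurj x.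
  rewrite -(subrK (phi y) y) linearD; apply: rpredD.
    by apply/CN/CE; exists (y - phi y); rewrite // linearB phiK subrr.
  exact: (singular_in_maximal hns hmp simple).
have Z0 (m : M) : singular m -> m = 0.
  have /CE[x phix0 <-] := Call m.
  by move/phi_id => <-; rewrite phix0 linear0.
apply: (projective_of_split (p := p) (phi := phi)) => // x.
  exact: Z0.
by move=> px0; apply: phi_id; rewrite px0; apply: singular0.
Qed.
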